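(* Let $k$ be an algebraically closed field, let $V$ be a $k$-vector space of finite even dimension with a nondegenerate symplectic form $(\,,):V\times V\to k$, let $G=Sp(V)$ be the group of all $T\in GL(V)$ preserving $(\,,)$, and let $\mathfrak g=\mathfrak s(V)=\{T\in\mathrm{End}(V);(Tv,v')+(v,Tv')=0\ \forall v,v'\in V\}$ be its Lie algebra. Let $V=\bigoplus_{i\in\mathbf Z}V_i$ be an $s$-good grading of $V$ and let $\delta:k^*\to G$ be the corresponding cocharacter, $\delta(a)|_{V_r}=a^r$ for all $a\in k^*$, $r\in\mathbf Z$. Then $$\mathfrak g_2^{\delta!}=\mathfrak s(V)_2^0 ,$$ that is: for $A\in\mathfrak s(V)$ with $A(V_r)\subset V_{r+2}$ for all $r$, the centralizer of $A$ in $G$ is contained in $G^\delta_{\ge0}$ if and only if $A^n:V_{-n}\to V_n$ is an isomorphism for every $n\ge0$.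
   Context: The characteristic of $k$ is arbitrary (it may be $2$); a symplectic form is an alternating bilinear form. A $\mathbf Z$-grading $V=\bigoplus_{i\in\mathbf Z}V_i$ is $s$-good if $\dim V_i=\dim V_{-i}\ge\dim V_{-i-2}$ for all $i\ge0$, $\dim V_i$ is even for any even $i$, and $(V_i,V_j)=0$ whenever $i+j\ne0$. (The cocharacters $\delta$ obtained from $s$-good gradings form the set denoted $\mathfrak D_G$.) For $i\in\mathbf Z$, $\mathfrak g_i^\delta=\{x\in\mathfrak g;\mathrm{Ad}(\delta(a))x=a^ix\ \forall a\in k^*\}=\mathfrak s(V)_i=\{A\in\mathfrak s(V);A(V_r)\subset V_{r+i}\ \forall r\}$. $G^\delta_{\ge0}$ is the parabolic subgroup of $G$ with Lie algebra $\bigoplus_{j\ge0}\mathfrak g_j^\delta$, i.e. the stabilizer in $G$ of all subspaces $V_{\ge a}=\sum_{j\ge a}V_j$. For $x\in\mathfrak g$, $G_x=\{g\in G;\mathrm{Ad}(g)x=x\}$, and $\mathfrak g_2^{\delta!}=\{x\in\mathfrak g_2^\delta;G_x\subset G^\delta_{\ge0}\}$. $\mathfrak s(V)_2^0$ is the set of all $A\in\mathfrak s(V)_2$ such that $A^n:V_{-n}\to V_n$ is an isomorphism for any $n\ge0$. *)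

(* Defs.v *)
From HB Require Import structures.
From mathcomp Require Import all_boot all_order all_algebra.
From mathcomp Require Export sesquilinear.

Set Implicit Arguments.
Unset Strict Implicit.
Unset Printing Implicit Defensive.

Import Order.TTheory GRing.Theory Num.Theory.
Local Open Scope ring_scope.

Section Symplectic.
Variables (k : fieldType) (V : vectType k) (B : {biscalar V}).

Definition alternating : Prop := forall v, B v v = 0.

Definition nondegenerate_form : Prop :=
  forall u, (forall v, B u v = 0) -> u = 0.

(* An injective endomorphism of the finite dimensional space V is an element *)
(* of GL(V).                                                                 *)
Definition Sp (g : 'End(V)) : Prop :=
  lker g = 0%VS /\ forall u v, B (g u) (g v) = B u v.

Definition sp_Lie (x : 'End(V)) : Prop :=
  forall u v, B (x u) v + B u (x v) = 0.

(* For g in GL(V), (g^-1)%VF is the two-sided inverse of g. *)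
Definition Ad (g x : 'End(V)) : 'End(V) := (g \o x \o g^-1)%VF.

Definition centralizer (x g : 'End(V)) : Prop := Sp g /\ Ad g x = x.

End Symplectic.

Section Grading.
Variables (k : fieldType) (V : vectType k) (B : {biscalar V}).
Variable Vg : int -> {vspace V}.

(* V is the direct sum of the Vg i. As V is finite dimensional, it is already *)
(* the sum of finitely many of them.                                          *)
Definition is_grading : Prop :=
  (forall s : seq int, uniq s -> directv (\sum_(i <- s) Vg i)) /\
  (exists s : seq int, (\sum_(i <- s) Vg i)%VS = fullv).

Definition s_good : Prop :=
  [/\ is_grading,
      forall i : int, 0 <= i ->
        \dim (Vg i) = \dim (Vg (- i)) /\
        (\dim (Vg (- i - 2)) <= \dim (Vg (- i)))%N,
      forall i : int, (2 %| i)%Z -> ~~ odd (\dim (Vg i))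
    & forall i j : int, i + j != 0 ->
        {in Vg i & Vg j, forall u v, B u v = 0}].

(* Only the values of delta on nonzero scalars are meaningful. *)
Definition is_cochar (delta : k -> 'End(V)) : Prop :=
  forall a : k, a != 0 ->
    forall (r : int) (v : V), v \in Vg r -> delta a v = a ^ r *: v.

(* Membership in the sum of the Vg j for j >= a. *)
Definition in_Vge (a : int) (v : V) : Prop :=
  exists2 s : seq int, all (fun j => a <= j) s & v \in (\sum_(j <- s) Vg j)%VS.

(* For g in GL(V), the last condition says that g maps each V_{>=a} onto *)
(* itself.                                                               *)
Definition G_ge0 (g : 'End(V)) : Prop :=
  Sp B g /\ forall (a : int) (v : V), in_Vge a (g v) <-> in_Vge a v.

Definition g_wt (delta : k -> 'End(V)) (i : int) (x : 'End(V)) : Prop :=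
  sp_Lie B x /\ forall a : k, a != 0 -> Ad (delta a) x = a ^ i *: x.

Definition g2_bang (delta : k -> 'End(V)) (x : 'End(V)) : Prop :=
  g_wt delta 2 x /\ forall g, centralizer B x g -> G_ge0 g.

Definition s_deg (i : int) (A : 'End(V)) : Prop :=
  sp_Lie B A /\ forall r : int, (A @: Vg r <= Vg (r + i))%VS.

Definition lfun_pow (A : 'End(V)) (n : nat) : 'End(V) :=
  iter n (comp_lfun A) \1%VF.

Definition restricts_to_iso (f : 'End(V)) (U W : {vspace V}) : Prop :=
  (f @: U)%VS = W /\ {in U &, injective f}.

Definition s2_0 (A : 'End(V)) : Prop :=
  s_deg 2 A /\
  forall n : nat, restricts_to_iso (lfun_pow A n) (Vg (- n%:Z)) (Vg n%:Z).

End Grading.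

(* Main.v *)
Require Import Defs.
From HB Require Import structures.
From mathcomp Require Import all_boot all_order all_algebra.
From mathcomp Require Import zify.

Set Implicit Arguments.
Unset Strict Implicit.
Unset Printing Implicit Defensive.

Import Order.TTheory GRing.Theory Num.Theory.
Local Open Scope ring_scope.

(** Suppose all A^n : V_{-n} -> V_n are bijective and T commutes with A. A
    vector v of V_{-n} is A u + w with u in V_{-n-2} and A^{n+1} w = 0; since
    the kernel of A^{n+1} lies in V_{>=-n}, descending induction gives
    T v in V_{>=-n}, and V_n = A^n V_{-n} takes care of the positive degrees.

    Conversely let A^n u = 0 with u <> 0 in V_{-n}, and let m < n be such that
    A^m u <> 0 = A^{m+1} u. For vectors a, b killed by A^{M+1}, the map
      x_{a,b}(v) = \sum_(i <= M) (-1)^i (A^{M-i} a, v) A^i b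
    commutes with A, and its adjoint is (-1)^{M+1} x_{b,a}. If some even M with
    m <= M <= m + 1 is smaller than n, take x = x_{u,u}. Otherwise m = n - 1 is
    odd; as V_{-n} has even dimension, the radical of the alternating form
    (v, A^n v') on it contains some w independent of u, and one takes
    x = x_{u,w} - x_{w,u} with M = m. In both cases x is in the Lie algebra,
    has negative degree, is nonzero, and x^2 = 0 because (A^i u, A^j u) and
    (A^i u, A^j w) vanish; hence 1 + x is an element of the centralizer of A in
    Sp(V) outside the parabolic. *)

Arguments lfun_pow : simpl never.

(** * Powers of an endomorphism *)

Section LfunPow.
Variables (k : fieldType) (V : vectType k) (A : 'End(V)).
Implicit Types (v : V) (m n : nat).

Lemma lfun_pow0 v : lfun_pow A 0 v = v.
Proof. exact: id_lfunE. Qed.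

Lemma lfun_powS n v : lfun_pow A n.+1 v = A (lfun_pow A n v).
Proof. exact: comp_lfunE. Qed.

Lemma lfun_powD m n v : lfun_pow A (m + n) v = lfun_pow A m (lfun_pow A n v).
Proof. by elim: m => [|m IH]; rewrite ?lfun_pow0 // addSn !lfun_powS IH. Qed.

Lemma lfun_powSr n v : lfun_pow A n.+1 v = lfun_pow A n (A v).
Proof. by rewrite -addn1 lfun_powD lfun_powS lfun_pow0. Qed.

Lemma lfun_pow_commute (T : 'End(V)) n v :
  (forall w, T (A w) = A (T w)) -> T (lfun_pow A n v) = lfun_pow A n (T v).
Proof.
by move=> TA; elim: n => [|n IH]; rewrite ?lfun_pow0 // !lfun_powS TA IH.
Qed.

Lemma lfun_pow_eq0 m n v :
  (m <= n)%N -> lfun_pow A m v = 0 -> lfun_pow A n v = 0.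
Proof. by move=> /subnK<- e; rewrite lfun_powD e linear0. Qed.

End LfunPow.

(** * Radicals of alternating forms on odd-dimensional spaces *)

Section Alternating.
Variables (k : fieldType) (V : vectType k) (B : {biscalar V}).

Lemma skew_of_alt (T : 'End(V)) :
  (forall v, B v (T v) = 0) -> forall u v, B u (T v) = - B v (T u).
Proof.
move=> alt u v; have := alt (u + v).
rewrite linearD /= linearDl !linearDr /= !alt add0r addr0 => /eqP.
by rewrite addr_eq0 => /eqP.
Qed.

Lemma dim_cap_ker (f : 'Hom(V, k^o)) (W : {vspace V}) w :
  w \in W -> f w != 0 -> (\dim (W :&: lker f)).+1 = \dim W.
Proof.
move=> Ww fw; rewrite -(limg_ker_dim f W) -addn1; congr (_ + _)%N.
apply/eqP; rewrite eq_sym eqn_leq; apply/andP; split.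
  by apply: leq_trans (dimvS (subvf _)) _; rewrite dimvf.
rewrite lt0n dimv_eq0; apply: contra fw => /eqP e.
by have := memv_img f Ww; rewrite e memv0.
Qed.

(** If the form [B u (T v)] is nonzero on [W], a hyperbolic pair [u], [v] splits off. Its orthogonal
    [W2] in [W] has dimension two less, hence still odd, and a radical vector of [W2] is also one
    for [W]. *)
Lemma alt_odd_radical (T : 'End(V)) (W : {vspace V}) :
  (forall v, B v (T v) = 0) -> odd (\dim W) ->
  exists w, [/\ w \in W, w != 0 & forall v, v \in W -> B v (T w) = 0].
Proof.
move=> alt; have sk := skew_of_alt alt.
pose f u : 'Hom(V, k^o) := linfun (B u \o T : V -> k^o).
have fE u v : f u v = B u (T v) by rewrite lfunE.
elim: {W}(\dim W) {-2}W (leqnn (\dim W)) => [|d IH] W.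
  by rewrite leqn0 => /eqP->.
move=> leWd oddW.
have W0 : W != 0%VS by apply: contraTneq oddW => ->; rewrite dimv0.
have [|nall] := boolP (all (fun u => all (fun v => f u v == 0) (vbasis W))
  (vbasis W)).
  have sub_ker x : all (fun v => f x v == 0) (vbasis W) -> (W <= lker (f x))%VS.
    move=> /allP zero; rewrite -(span_basis (vbasisP W)).
    by apply/span_subvP => v /zero; rewrite memv_ker.
  move=> /allP zero; exists (vpick W); split; rewrite ?memv_pick ?vpick0 //.
  move=> v Wv; rewrite -fE; apply/eqP.
  suff /subvP/(_ _ (memv_pick W)) : (W <= lker (f v))%VS by rewrite memv_ker.
  apply/sub_ker/allP => u /zero/sub_ker/subvP/(_ v Wv).
  by rewrite memv_ker !fE sk oppr_eq0.
have {nall} [u [v [Wu Wv fuv]]] : exists u v, [/\ u \in W, v \in W & f u v != 0].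
  have [u /vbasis_mem Wu /allPn[v /vbasis_mem Wv ?]] := allPn nall.
  by exists u, v.
pose W1 := (W :&: lker (f u))%VS.
have W1u : u \in W1 by rewrite memv_cap Wu memv_ker fE alt eqxx.
have fvu : f v u != 0 by rewrite fE sk oppr_eq0 -fE.
pose W2 := (W1 :&: lker (f v))%VS.
have d1 := dim_cap_ker Wv fuv; have d2 := dim_cap_ker W1u fvu.
have [|| w [W2w w0 rad]] := IH W2; first by rewrite -/W1 -/W2 in d1 d2; lia.
  by rewrite -/W1 -/W2 in d1 d2; move: oddW; rewrite -d1 -d2 /= negbK.
move: (W2w); rewrite !memv_cap !memv_ker !fE => /andP[/andP[Ww /eqP uw] /eqP vw].
exists w; split=> // x Wx.
(* [y] is the component of [x] orthogonal to the plane of [u] and [v]; each coefficient is read off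
   by pairing [x] with the other vector. *)
pose y := x - (f v x / f v u) *: u - (f u x / f u v) *: v.
have W2y : y \in W2.
  have Wy : y \in W by rewrite /y !rpredB ?rpredZ.
  have fy z : f z y = f z x - (f v x / f v u) * f z u - (f u x / f u v) * f z v.
    by rewrite /y !linearB !linearZ.
  have f0 z : f z z = 0 by rewrite fE alt.
  rewrite !memv_cap !memv_ker Wy !fy !f0 !divfK // !mulr0 !subr0.
  by rewrite !subrr !eqxx.
have : x = y + (f v x / f v u) *: u + (f u x / f u v) *: v.
  by rewrite /y addrAC !subrK.
move: y W2y => y W2y ->.
by rewrite !linearDl !linearZl_LR /= uw vw rad // !mulr0 !addr0.
Qed.

End Alternating.

(** * Projections onto the graded pieces *)

Section GradingProjections.
Variables (k : fieldType) (V : vectType k) (Vg : int -> {vspace V}).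

Lemma grading_projections : is_grading Vg ->
  exists (p : int -> 'End(V)) (S : seq int),
    [/\ forall i v, p i v \in Vg i,
        forall i j v, v \in Vg j -> p i v = if i == j then v else 0
      & forall v, v = \sum_(i <- S) p i v].
Proof.
(* Directness is given for duplicate-free lists only, while the spanning list may repeat indices. *)
case=> dir [S0 full0]; pose S := undup S0.
have full : (\sum_(i <- S) Vg i)%VS = fullv.
  by rewrite -full0 big_undup //; apply: addvv.
pose C i := (\sum_(j <- S | j != i) Vg j)%VS.
have dC i : (Vg i :&: C i = 0)%VS.
  have uS : uniq [seq j <- S | j != i] by rewrite filter_uniq ?undup_uniq.
  have := dir (i :: [seq j <- S | j != i]); have := dir _ uS.
  rewrite /= mem_filter eqxx uS !directvE /= !big_cons => /eqP <- /(_ isT) dim_eq.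
  apply/eqP; rewrite -subv0 -(dimv_add_leqif _ _).2 /C -big_filter.
  exact: dim_eq.
have sC i j : j != i -> (Vg j <= C i)%VS.
  move=> ji; have [Sj|nSj] := boolP (j \in S).
    by rewrite /C (big_rem j) //= ji addvSl.
  (* For [j] outside [S], [C j] is the whole space, and [Vg j] meets it trivially. *)
  suff -> : Vg j = 0%VS by apply: sub0v.
  rewrite -(capvf (Vg j)) -full -[RHS](dC j) /C [in RHS]big_seq_cond.
  rewrite [in LHS]big_seq; congr (_ :&: _)%VS; apply: eq_bigl => l.
  by have [Sl|//] := boolP (l \in S); apply/esym; apply: contraNneq nSj => <-.
exists (fun i => daddv_pi (Vg i) (C i)), S.
have pE i j v : v \in Vg j -> daddv_pi (Vg i) (C i) v = if i == j then v else 0.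
  have [<-|ij] := eqVneq i j; first exact: daddv_pi_id.
  move=> jv; have Cv : v \in C i by apply: subvP jv; apply: sC; rewrite eq_sym.
  have := daddv_pi_add (dC i) (subvP (addvSr (Vg i) (C i)) v Cv).
  rewrite [daddv_pi (C i) _ v]daddv_pi_id // 1?capvC //.
  by rewrite -[RHS]add0r => /addIr.
split=> // [i v|v]; first exact: memv_pi.
have : v \in (\sum_(i <- S) Vg i)%VS by rewrite full memvf.
have : {subset S <= S} by [].
elim: {1 3}S v => [|i s IH] v sS.
  by rewrite big_nil memv0 => /eqP->; rewrite big1 // => i _; rewrite linear0.
rewrite big_cons => /memv_addP[u iu [w sw ->]].
rewrite [in LHS](IH w) //; last by move=> j sj; rewrite sS // in_cons sj orbT.
under [RHS]eq_bigr do rewrite linearD /=; rewrite big_split /=; congr (_ + _).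
have Si : i \in S by rewrite sS ?mem_head.
rewrite (bigD1_seq i) ?undup_uniq //= (pE i i) // eqxx big1 ?addr0 // => j ji.
by rewrite (pE j i) // (negPf ji).
Qed.

End GradingProjections.

(** * The filtration by degree and the action of a map of degree 2 *)

Section Graded.
Variables (k : fieldType) (V : vectType k) (Vg : int -> {vspace V}).
Variables (p : int -> 'End(V)) (S : seq int).
Hypothesis p_mem : forall i v, p i v \in Vg i.
Hypothesis pE : forall i j v, v \in Vg j -> p i v = if i == j then v else 0.
Hypothesis p_sum : forall v, v = \sum_(i <- S) p i v.

Lemma p_eq0 v : (forall i, p i v = 0) -> v = 0.
Proof. by move=> v0; rewrite [v]p_sum big1. Qed.

Lemma in_VgeP a v : in_Vge Vg a v <-> forall i, i < a -> p i v = 0.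
Proof.
split=> [[s + +] i ia|v0].
  elim: s v => [|j s IH] v /=; first by
    rewrite big_nil memv0 => _ /eqP->; rewrite linear0.
  case/andP=> aj sa; rewrite big_cons => /memv_addP[u ju [w sw ->]].
  rewrite linearD /= (IH w) // addr0 (pE i ju); case: eqP aj => // <-.
  by rewrite leNgt ia.
exists [seq i <- S | a <= i]; first exact: filter_all.
rewrite [v]p_sum (bigID (fun i => a <= i)) /= addrC big1 ?add0r.
  rewrite -big_filter; elim: (filter _ _) => [|j s IH].
    by rewrite !big_nil mem0v.
  by rewrite !big_cons memv_add.
by move=> i; rewrite -ltNge => /v0.
Qed.

Lemma in_Vge_sub a b v : a <= b -> in_Vge Vg b v -> in_Vge Vg a v.
Proof.
move=> ab /in_VgeP bv; apply/in_VgeP => i ia; apply: bv.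
exact: lt_le_trans ia ab.
Qed.

Lemma in_VgeD a u v : in_Vge Vg a u -> in_Vge Vg a v -> in_Vge Vg a (u + v).
Proof.
move=> /in_VgeP ua /in_VgeP va; apply/in_VgeP => i ia.
by rewrite linearD /= ua ?va ?addr0.
Qed.

Lemma grading_bounded : exists N : nat, forall (n : nat) v,
  (N < n)%N -> v \in Vg (- n%:Z) -> v = 0.
Proof.
exists (\max_(i <- S) `|i|%N) => n v Nn nv.
rewrite [v]p_sum big_seq big1 // => i Si.
rewrite (pE i nv); case: eqP => // ei; move: Nn.
have := @leq_bigmax_seq _ S predT (fun i => `|i|%N) i Si isT.
by rewrite ei /=; lia.
Qed.

Section Homogeneous.
Variable A : 'End(V).
Hypothesis A_deg : forall r v, v \in Vg r -> A v \in Vg (r + 2).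

Lemma lfun_pow_mem n r v : v \in Vg r -> lfun_pow A n v \in Vg (r + n%:Z *+ 2).
Proof.
move=> rv; elim: n => [|n IH]; first by rewrite lfun_pow0 mul0rn addr0.
rewrite lfun_powS (_ : r + _ = r + n%:Z *+ 2 + 2); first exact: A_deg.
lia.
Qed.

Lemma p_lfun_pow n i v : p (i + n%:Z *+ 2) (lfun_pow A n v) = lfun_pow A n (p i v).
Proof.
rewrite {1}[v]p_sum {2}[v]p_sum !linear_sum; apply: eq_bigr => j _ /=.
rewrite (pE _ (lfun_pow_mem n (p_mem j v))) (pE i (p_mem j v)).
rewrite (inj_eq (addIr _)); case: eqP => // _.
by rewrite linear0.
Qed.

(** The power [A^n] carries components to components, so for [n >= m] it kills the component of [v]
    in degree [-n]; injectivity in that degree makes this component zero. *)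
Lemma ker_pow_Vge (m : nat) v :
  (forall (n : nat) u, u \in Vg (- n%:Z) -> lfun_pow A n u = 0 -> u = 0) ->
  lfun_pow A m v = 0 -> in_Vge Vg (1 - m%:Z) v.
Proof.
move=> inj v0; apply/in_VgeP => i im.
have [n en] : exists n : nat, i = - n%:Z by exists `|i|%N; lia.
have mn : (m <= n)%N by lia.
rewrite en; apply: (inj n) => //.
by rewrite -p_lfun_pow (lfun_pow_eq0 mn v0) linear0.
Qed.

Lemma pow_Vge n a v : in_Vge Vg a v -> in_Vge Vg (a + n%:Z *+ 2) (lfun_pow A n v).
Proof.
move=> /in_VgeP va; apply/in_VgeP => i ia.
have -> : i = i - n%:Z *+ 2 + n%:Z *+ 2 by rewrite subrK.
by rewrite p_lfun_pow va ?linear0 //; lia.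
Qed.

Lemma commute_Vge (T : 'End(V)) a v :
  (forall n : nat, restricts_to_iso (lfun_pow A n) (Vg (- n%:Z)) (Vg n%:Z)) ->
  (forall w, T (A w) = A (T w)) -> in_Vge Vg a v -> in_Vge Vg a (T v).
Proof.
move=> iso TA.
have inj (n : nat) u : u \in Vg (- n%:Z) -> lfun_pow A n u = 0 -> u = 0.
  by move=> nu u0; have [_] := iso n; apply; rewrite ?mem0v ?u0 ?linear0.
have surj (n : nat) u : u \in Vg n%:Z ->
    exists2 w, w \in Vg (- n%:Z) & u = lfun_pow A n w.
  by have [<- _] := iso n => /memv_imgP.
have [N VN] := grading_bounded.
have neg (n : nat) : forall u, u \in Vg (- n%:Z) -> in_Vge Vg (- n%:Z) (T u).
  (* [d] turns the descending induction into an ordinary one: passing from [-n] to [-n-2] lowers it,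
     and at [d = 0] the piece is zero. *)
  have [d] : exists d, (N < n + d)%N by exists N.+1; lia.
  elim: d n => [|d IH] n Nn u nu.
    rewrite (VN n u) //; last by rewrite addn0 in Nn.
    by apply/in_VgeP => i _; rewrite !linear0.
  (* [A^(n+1) u] lies in degree [n+2], where [A^(n+2)] is onto; this yields [w] with [u - A w]
     killed by [A^(n+1)]. *)
  have [|w nw ew] := surj n.+2 (lfun_pow A n.+1 u).
    by rewrite (_ : n.+2%:Z = - n%:Z + n.+1%:Z *+ 2) ?lfun_pow_mem //; lia.
  have Tw : in_Vge Vg (- n.+2%:Z) (T w) by apply: IH => //; lia.
  have -> : u = A w + (u - A w) by rewrite addrC subrK.
  rewrite linearD /=; apply: in_VgeD.
    have := pow_Vge 1 Tw; rewrite lfun_powS lfun_pow0 -TA.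
    by congr (in_Vge Vg _ _); lia.
  have -> : - n%:Z = 1 - n.+1%:Z by lia.
  apply: ker_pow_Vge => //.
  by rewrite -lfun_pow_commute // linearB /= -lfun_powSr ew subrr linear0.
have all_deg r u : u \in Vg r -> in_Vge Vg r (T u).
  have [[n ->]|[n ->]] : (exists n : nat, r = n%:Z) \/ exists n : nat, r = - n%:Z.
  - by have [?|?] := leP 0 r; [left|right]; exists `|r|%N; lia.
  - move=> /surj[w nw ->]; rewrite lfun_pow_commute //.
    have := pow_Vge n (neg n w nw).
    by congr (in_Vge Vg _ _); lia.
  exact: neg.
move=> /in_VgeP va; rewrite [v]p_sum linear_sum /=.
elim: S => [|i s IH]; first by rewrite big_nil; apply/in_VgeP => i _; rewrite linear0.
rewrite big_cons; apply: in_VgeD IH.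
have [ai|/va->] := leP a i; last by apply/in_VgeP => j _; rewrite !linear0.
exact: in_Vge_sub ai (all_deg _ _ (p_mem i v)).
Qed.

End Homogeneous.

Lemma cochar_p (delta : k -> 'End(V)) a i v : is_cochar Vg delta -> a != 0 ->
  p i (delta a v) = a ^ i *: p i v.
Proof.
move=> dl a0; rewrite {1}[v]p_sum {2}[v]p_sum !linear_sum; apply: eq_bigr => j _ /=.
rewrite (dl a a0 j) // linearZ /= (pE i (p_mem j v)); case: eqP => [->|] //.
by rewrite !scaler0.
Qed.

Lemma cochar_inj (delta : k -> 'End(V)) a : is_cochar Vg delta -> a != 0 ->
  lker (delta a) == 0%VS.
Proof.
move=> dl a0; apply/lker0P => u v euv; apply/eqP; rewrite -subr_eq0; apply/eqP.
apply: p_eq0 => i; apply/eqP.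
have := cochar_p i (u - v) dl a0; rewrite linearB /= euv subrr linear0.
by move=> /esym/eqP; rewrite scaler_eq0 expfz_eq0 (negPf a0) andbF.
Qed.

End Graded.

(** * Weights of the cocharacter versus degrees *)

Lemma exprz_neq1 (k : closedFieldType) (d : int) : d != 0 ->
  exists2 a : k, a != 0 & a ^ d != 1.
Proof.
(* The factor ['X] forces the non-root to be nonzero. *)
move=> d0; pose q : {poly k} := 'X * ('X^(`|d|%N) - 1).
have /closed_nonrootP[a] : q != 0.
  rewrite mulf_eq0 polyX_eq0 /= -size_poly_eq0 size_XnsubC //; lia.
rewrite rootM !rootE !hornerE subr_eq0 negb_or => /andP[a0 ad].
exists a => //; apply: contra ad; case: d {d0 q} => n /=; first exact.
by rewrite NegzE -invr_expz invr_eq1.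
Qed.

(** For [v] of degree [r], the weight condition evaluated at [delta a v] multiplies the degree [i]
    component of [x v] by [a^i] on one side and by [a^(r+d)] on the other. A suitable [a] separates
    these unless [i = r + d]. *)
Lemma g_wt_s_deg (k : closedFieldType) (V : vectType k) (B : {biscalar V})
    (Vg : int -> {vspace V}) (delta : k -> 'End(V)) (d : int) (x : 'End(V)) :
  is_grading Vg -> is_cochar Vg delta ->
  g_wt B delta d x <-> s_deg B Vg d x.
Proof.
move=> /grading_projections[p [S [p_mem pE p_sum]]] dl.
split=> [[spx wt]|[spx dx]]; split=> //.
  move=> r; apply/subvP => _ /memv_imgP[v rv ->].
  suff p0 i : i != r + d -> p i (x v) = 0.
    have -> : x v = p (r + d) (x v); last exact: p_mem.
    apply/eqP; rewrite -subr_eq0; apply/eqP/(p_eq0 p_sum) => i.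
    rewrite linearB /= (pE _ _ _ (p_mem (r + d) _)).
    by case: eqP => [->|/eqP/p0->]; rewrite subrr.
  rewrite -subr_eq0 => /(exprz_neq1 k)[a a0 ad].
  have := congr1 (fun f : 'End(V) => p i (f (delta a v))) (wt a a0).
  rewrite /Ad !comp_lfunE lker0_lfunK ?(cochar_inj p_mem pE p_sum) //.
  rewrite scale_lfunE linearZ /= (dl a a0 r v rv) !linearZ /=.
  rewrite (cochar_p p_mem pE p_sum) // scalerA => /eqP.
  rewrite -subr_eq0 -scalerBl scaler_eq0 => /orP[|/eqP//].
  rewrite -expfzDr // subr_eq0 => /eqP e; case/negP: ad.
  by rewrite expfzDr // e -invr_expz divff ?expfz_neq0.
move=> a a0; have inj := cochar_inj p_mem pE p_sum dl a0.
rewrite /Ad; suff -> : (delta a \o x = (a ^ d *: x) \o delta a)%VF.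
  by rewrite -comp_lfunA lker0_compfV // comp_lfun1r.
apply/lfunP => v; rewrite !comp_lfunE scale_lfunE [v]p_sum !linear_sum /=.
apply: eq_bigr => i _.
rewrite (dl a a0 i (p i v)) // linearZ /= scalerA -expfzDr // addrC.
by rewrite (dl a a0 (i + d)) // (subvP (dx i)) ?memv_img.
Qed.

(** * Square-zero elements commuting with [A] *)

Section StringMap.
Variables (k : fieldType) (V : vectType k) (B : {biscalar V}) (A : 'End(V)).
Implicit Types (m n : nat) (a b u v : V).

Definition string_fun m a b v :=
  \sum_(i < m.+1) ((-1) ^+ i * B (lfun_pow A (m - i) a) v) *: lfun_pow A i b.

Fact string_fun_is_linear m a b : linear (string_fun m a b).
Proof.
move=> c u v; rewrite /string_fun scaler_sumr -big_split /=; apply: eq_bigr => i _.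
by rewrite linearPr /= mulrDr scalerDl scalerA mulrCA.
Qed.

HB.instance Definition _ m a b :=
  GRing.isLinear.Build k V V *:%R (string_fun m a b) (string_fun_is_linear m a b).

Definition string_map m a b : 'End(V) := linfun (string_fun m a b).

Lemma string_mapE m a b v : string_map m a b v =
  \sum_(i < m.+1) ((-1) ^+ i * B (lfun_pow A (m - i) a) v) *: lfun_pow A i b.
Proof. by rewrite lfunE. Qed.

Hypothesis spA : sp_Lie B A.

Lemma form_lfun_pow n u v :
  B (lfun_pow A n u) v = (-1) ^+ n * B u (lfun_pow A n v).
Proof.
elim: n v => [|n IH] v; first by rewrite !lfun_pow0 mul1r.
rewrite lfun_powS [in RHS]lfun_powSr; have /eqP := spA (lfun_pow A n u) v.
by rewrite addr_eq0 => /eqP ->; rewrite IH exprS !mulN1r mulNr.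
Qed.

(** Moving [A] across the form costs a sign and raises the power on [a], so term [i+1] on the left
    is term [i] on the right. The two unmatched end terms contain [A^(m+1) a] and [A^(m+1) b]. *)
Lemma string_map_commute m a b v :
  lfun_pow A m.+1 a = 0 -> lfun_pow A m.+1 b = 0 ->
  string_map m a b (A v) = A (string_map m a b v).
Proof.
move=> a0 b0; rewrite !string_mapE linear_sum big_ord_recl big_ord_recr /=.
rewrite linearZ /= -lfun_powS b0 scaler0 addr0 subn0.
have AB w : B w (A v) = - B (A w) v.
  by have /eqP := spA w v; rewrite addrC addr_eq0 => /eqP.
rewrite AB -lfun_powS a0 linear0l oppr0 mulr0 scale0r add0r.
apply: eq_bigr => i _; rewrite linearZ /= AB -!lfun_powS /bump add1n.
by rewrite subnSK // exprS mulN1r mulrN mulNr opprK.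
Qed.

Hypothesis alt : alternating B.

Lemma form_skew u v : B u v = - B v u.
Proof.
have altB w : B w (\1%VF w) = 0 by rewrite id_lfunE alt.
by have := skew_of_alt altB u v; rewrite !id_lfunE.
Qed.

(** Reversing the sum exchanges the roles of [a] and [b] at the cost of [(-1)^m]; skew-symmetry of
    [B] supplies the remaining sign. *)
Lemma string_map_adjoint m a b u v :
  B (string_map m a b u) v = (-1) ^+ m.+1 * B u (string_map m b a v).
Proof.
rewrite !string_mapE linear_sumlz linear_sumr mulr_sumr (reindex_inj rev_ord_inj) /=.
apply: eq_bigr => i _; rewrite linearZl_LR linearZr_LR /= subSS (subKn (leq_ord i)).
rewrite [B u _]form_skew (form_skew (lfun_pow A i a)) exprS.
have -> : (-1) ^+ m = (-1) ^+ (m - i) * (-1) ^+ i :> k by rewrite -exprD (subnK (leq_ord i)).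
rewrite !mulrA !mulrN !mulN1r !mulNr opprK.
by rewrite -[_ * (-1) ^+ i * (-1) ^+ i]mulrA -expr2 sqrr_sign mulr1 mulrAC.
Qed.

Lemma string_map_sp m a : ~~ odd m -> sp_Lie B (string_map m a a).
Proof.
move=> om u v; rewrite string_map_adjoint -signr_odd /= om.
by rewrite expr1 mulN1r addNr.
Qed.

Lemma string_mapB_sp m a b :
  odd m -> sp_Lie B (string_map m a b - string_map m b a).
Proof.
move=> om u v; rewrite !add_lfunE !opp_lfunE linearBl linearBr /=.
rewrite !string_map_adjoint -signr_odd /= om !mul1r.
by rewrite -[X in _ + X]opprB subrr.
Qed.

Lemma string_map_comp0 m a b c d v :
  (forall i j, B (lfun_pow A i a) (lfun_pow A j d) = 0) ->
  string_map m a b (string_map m c d v) = 0.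
Proof.
move=> ad; rewrite (string_mapE m a b) big1 // => i _.
rewrite string_mapE linear_sumr big1 ?mulr0 ?scale0r // => j _.
by rewrite linearZr_LR /= ad mulr0.
Qed.

(** As [x] is skew with [x^2 = 0], the term [B (x u) (x v)] vanishes, so [1 + x] is an isometry in
    every characteristic. Injectivity follows by applying [x] to [w + x w = 0]. *)
Lemma centralizer_1D (x : 'End(V)) :
  sp_Lie B x -> (forall v, x (x v) = 0) -> (forall v, x (A v) = A (x v)) ->
  centralizer B A (\1 + x)%VF.
Proof.
move=> spx x2 xA; have gE v : (\1 + x)%VF v = v + x v by rewrite add_lfunE id_lfunE.
have ker0 : lker (\1 + x)%VF = 0%VS.
  apply/eqP/lker0P => u v; rewrite !gE => /eqP; rewrite -subr_eq0 opprD addrACA -linearB /=.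
  set w := u - v => /eqP w0.
  have xw : x w = 0 by have := congr1 x w0; rewrite linearD /= x2 addr0 linear0.
  by apply/eqP; rewrite -subr_eq0 -/w; move: w0; rewrite xw addr0 => ->.
split; first split=> // u v.
  have /eqP := spx u v; rewrite addr_eq0 => /eqP xuv.
  have := spx u (x v); rewrite x2 linear0r addr0 => xuxv.
  by rewrite !gE linearDl !linearDr /= xuv xuxv addr0 addrK.
rewrite /Ad; have -> : ((\1 + x) \o A = A \o (\1 + x))%VF.
  by apply/lfunP => v; rewrite !comp_lfunE !gE linearD /= xA.
by rewrite -comp_lfunA lker0_compfV ?ker0 // comp_lfun1r.
Qed.

End StringMap.

(** * Centralizer in the parabolic implies injectivity of the powers *)

Section ParabolicCentralizer.
Variables (k : fieldType) (V : vectType k) (B : {biscalar V}).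
Variables (Vg : int -> {vspace V}) (A : 'End(V)).
Hypothesis alt : alternating B.
Hypothesis nondeg : nondegenerate_form B.
Hypothesis grad : is_grading Vg.
Hypothesis orth : forall i j : int, i + j != 0 ->
  {in Vg i & Vg j, forall u v, B u v = 0}.
Hypothesis spA : sp_Lie B A.
Hypothesis A_deg : forall r v, v \in Vg r -> A v \in Vg (r + 2).
Hypothesis cent_ge0 : forall g, centralizer B A g -> G_ge0 B Vg g.

Lemma graded_nondeg s w :
  w \in Vg s -> (forall v, v \in Vg (- s) -> B w v = 0) -> w = 0.
Proof.
have [p [S [p_mem pE p_sum]]] := grading_projections grad.
move=> sw w0; apply: nondeg => v; rewrite [v]p_sum linear_sumr big1 // => i _.
have [si|si] := eqVneq (s + i) 0; last exact: orth si _ _ sw (p_mem i v).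
by apply: w0; have -> : - s = i by lia.
Qed.

(** [1 + x] centralizes [A], hence preserves [V_{>=r}]; but [x v] is the component of [v + x v] in
    the lower degree [s]. *)
Lemma centralizer_no_lowering (x : 'End(V)) r s v :
  sp_Lie B x -> (forall v, x (x v) = 0) -> (forall v, x (A v) = A (x v)) ->
  v \in Vg r -> x v \in Vg s -> s < r -> x v = 0.
Proof.
move=> spx x2 xA rv sxv sr.
have [p [S [p_mem pE p_sum]]] := grading_projections grad.
have [_ /(_ r v)[_]] := cent_ge0 (centralizer_1D spx x2 xA).
have Vv : in_Vge Vg r v.
  apply/(in_VgeP p_mem pE p_sum) => i ir; rewrite (pE i r v rv).
  by case: eqP ir => // ->; rewrite ltxx.
move=> /(_ Vv)/(in_VgeP p_mem pE p_sum)/(_ s sr).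
rewrite add_lfunE id_lfunE linearD /= (pE s r v rv) (pE s s _ sxv) eqxx.
by case: eqP sr => [->|_ _]; rewrite ?ltxx // add0r.
Qed.

(** Up to sign this is [B a (A^(i+j) b)]: for [i + j >= n] the power kills [b], and otherwise the
    two degrees have negative sum. *)
Lemma form_pow_isotropic n a b i j :
  a \in Vg (- n%:Z) -> b \in Vg (- n%:Z) -> lfun_pow A n b = 0 ->
  B (lfun_pow A i a) (lfun_pow A j b) = 0.
Proof.
move=> na nb b0; rewrite form_lfun_pow // -lfun_powD.
have [/lfun_pow_eq0->//|ij] := leqP n (i + j); first by rewrite linear0r mulr0.
rewrite (orth _ na (lfun_pow_mem A_deg (i + j) nb)) ?mulr0 //; lia.
Qed.

(** Only the term [i = M - m] pairs vectors of opposite degrees. *)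
Lemma string_map_graded n m M a b v :
  (m <= M)%N -> a \in Vg (- n%:Z) -> v \in Vg (n%:Z - m%:Z *+ 2) ->
  string_map B A M a b v =
    ((-1) ^+ (M - m) * B (lfun_pow A m a) v) *: lfun_pow A (M - m) b.
Proof.
move=> mM na nv; have lt : (M - m < M.+1)%N by lia.
rewrite string_mapE (bigD1 (Ordinal lt)) //= subKn // big1 ?addr0 // => i.
rewrite -val_eqE /= => im.
rewrite (orth _ (lfun_pow_mem A_deg (M - i) na) nv) ?mulr0 ?scale0r //.
by have := ltn_ord i; lia.
Qed.

(** The map [x_{u,u}] shifts degrees by [2(M - n) < 0], so it vanishes on [V_{n-2m}]. If [A^(M-m) u]
    were nonzero, [A^m u] would be orthogonal to that piece, hence zero. *)
Lemma no_even_string n m M u :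
  u \in Vg (- n%:Z) -> ~~ odd M -> (m <= M < n)%N -> lfun_pow A M.+1 u = 0 ->
  lfun_pow A m u != 0 -> lfun_pow A (M - m) u = 0.
Proof.
move=> nu oM /andP[mM Mn] u0 um; apply/eqP; apply: contraNT um => uMm; apply/eqP.
have nmu := lfun_pow_mem A_deg m nu.
apply: (graded_nondeg nmu) => v vdeg.
have {}vdeg : v \in Vg (n%:Z - m%:Z *+ 2) by rewrite opprD opprK in vdeg.
have xv := string_map_graded u mM nu vdeg.
have : string_map B A M u u v = 0.
  apply: (@centralizer_no_lowering _ _ (- n%:Z + (M - m)%:Z *+ 2) _ _ _ _ vdeg).
  - exact: string_map_sp.
  - move=> w; apply: string_map_comp0 => i j.
    exact: (form_pow_isotropic _ _ nu nu (lfun_pow_eq0 Mn u0)).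
  - by move=> w; apply: string_map_commute.
  - by rewrite xv rpredZ // lfun_pow_mem.
  by rewrite /=; lia.
move/eqP; rewrite xv scaler_eq0 (negPf uMm) orbF mulf_eq0 signr_eq0 /=.
by move/eqP.
Qed.

(** [x_{u,w} - x_{w,u}] lowers degrees by 2 and so vanishes; independence of [u] and [w] isolates
    the coefficient [B (A^n u) v]. *)
Lemma no_odd_string n u w :
  odd n -> u \in Vg (- n.+1%:Z) -> w \in Vg (- n.+1%:Z) -> w \notin <[u]>%VS ->
  lfun_pow A n.+1 u = 0 -> lfun_pow A n.+1 w = 0 -> lfun_pow A n u = 0.
Proof.
move=> on nu nw uw u0 w0.
apply: (graded_nondeg (lfun_pow_mem A_deg n nu)) => v vdeg.
have {}vdeg : v \in Vg (n.+1%:Z - n%:Z *+ 2) by rewrite opprD opprK in vdeg.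
pose x := string_map B A n u w - string_map B A n w u.
have xv : x v = B (lfun_pow A n u) v *: w - B (lfun_pow A n w) v *: u.
  rewrite add_lfunE opp_lfunE !(string_map_graded _ (leqnn n) _ vdeg) //.
  by rewrite subnn !lfun_pow0 !mul1r.
have : x v = 0.
  apply: (@centralizer_no_lowering _ _ (- n.+1%:Z) _ _ _ _ vdeg).
  - exact: string_mapB_sp.
  - move=> y; rewrite [x y]add_lfunE opp_lfunE linearB /= !add_lfunE !opp_lfunE.
    by rewrite !string_map_comp0 ?subrr // => i j; apply: (@form_pow_isotropic n.+1).
  - by move=> y; rewrite !add_lfunE !opp_lfunE linearB /= !string_map_commute.
  - by rewrite xv rpredB // rpredZ.
  by rewrite /=; lia.
move/eqP; rewrite xv subr_eq0 => /eqP e; apply/eqP; apply: contraNT uw => c0.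
apply/vlineP; exists ((B (lfun_pow A n u) v)^-1 * B (lfun_pow A n w) v).
by rewrite -scalerA -e scalerA mulVf // scale1r.
Qed.

(* The form B u (A^n v) on V_{-n} is alternating for even n, so on a space of *)
(* even dimension its radical cannot be a line.                               *)
Lemma second_radical_vector n u :
  ~~ odd n -> ~~ odd (\dim (Vg (- n%:Z))) -> u \in Vg (- n%:Z) -> u != 0 ->
  lfun_pow A n u = 0 ->
  exists w, [/\ w \in Vg (- n%:Z), w \notin <[u]>%VS & lfun_pow A n w = 0].
Proof.
move=> en edim nu u0 An.
have altA v : B v (lfun_pow A n v) = 0.
  (* With [n = 2h], the value is [B (A^h v) (A^h v)] up to sign. *)
  rewrite -[n]odd_double_half (negPf en) add0n -addnn lfun_powD.
  have := form_lfun_pow spA n./2 v (lfun_pow A n./2 v).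
  rewrite alt => /esym/eqP; rewrite mulf_eq0 signr_eq0 /=.
  by move/eqP.
(* Since [A^n u = 0], the vector [u] is already in the radical; a radical vector on this
   odd-dimensional complement of its line is therefore radical on all of [V_{-n}]. *)
pose W := (Vg (- n%:Z) :\: <[u]>)%VS.
have Wcap : (W :&: <[u]> = 0)%VS by apply: capv_diff.
have Wadd : (W + <[u]> = Vg (- n%:Z))%VS.
  by rewrite addv_diff; apply/addv_idPl; rewrite -memvE.
have oW : odd (\dim W).
  move: edim; rewrite -Wadd dimv_disjoint_sum // dim_vline u0 addn1 /=.
  by rewrite negbK.
have [w [Ww w0 rad]] := alt_odd_radical altA oW.
have nw : w \in Vg (- n%:Z) by apply: subvP Ww; apply: diffvSl.
exists w; split=> //.
  apply: contra w0 => uw; rewrite -memv0 -Wcap memv_cap Ww //.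
apply: (graded_nondeg (lfun_pow_mem A_deg n nw)) => v vdeg.
have {vdeg} : v \in (W + <[u]>)%VS by rewrite Wadd; move: vdeg; congr (v \in Vg _); lia.
case/memv_addP => y Wy [_ /vlineP[c ->] ->].
rewrite form_skew // linearDl linearZl_LR /= rad // add0r.
by rewrite (skew_of_alt altA) An linear0r oppr0 mulr0 oppr0.
Qed.

Lemma pow_inj_of_cent_ge0 n u : (~~ odd n -> ~~ odd (\dim (Vg (- n%:Z)))) ->
  u \in Vg (- n%:Z) -> lfun_pow A n u = 0 -> u = 0.
Proof.
move=> edim nu un; apply/eqP/negPn/negP => u0.
have ex : exists m, lfun_pow A m.+1 u == 0.
  by exists n; rewrite lfun_powS un linear0.
case: (ex_minnP ex) => m /eqP um min.
have um0 : lfun_pow A m u != 0.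
  case: m um min => [|m] um min; first by rewrite lfun_pow0.
  by apply/negP => /min; rewrite ltnn.
have mn : (m < n)%N.
  by rewrite ltnNge; apply: contra um0 => nm; rewrite (lfun_pow_eq0 nm un).
(* [m + odd m] is the least even [M >= m]. If it is below [n], the even case gives
   [A^(odd m) u = 0], against [A^m u != 0]. *)
have [Mn|nM] := ltnP (m + odd m) n.
  have : lfun_pow A (m + odd m - m) u = 0.
    apply: no_even_string nu _ _ _ um0.
    - by rewrite oddD; case: (odd m).
    - by rewrite leq_addr.
    by apply: lfun_pow_eq0 um; lia.
  rewrite addKn => /(@lfun_pow_eq0 _ _ A _ m) e; case/eqP: um0; apply: e.
  by case: m {um min mn Mn} => // m; case: (odd _).
have om : odd m by case: (odd m) nM => //; lia.
have en : n = m.+1 by rewrite om in nM; lia.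
rewrite en in edim nu un.
have [||w [nw uw wn]] := second_radical_vector _ _ nu u0 un.
- by rewrite /= om.
- by apply: edim; rewrite /= om.
by case/eqP: um0; apply: (no_odd_string om nu nw uw un wn).
Qed.

End ParabolicCentralizer.

(** * The equivalence *)

Theorem mainTheorem4 (k : closedFieldType) (V : vectType k) (B : {biscalar V})
    (Vg : int -> {vspace V}) (delta : k -> 'End(V)) :
  ~~ odd (\dim {:V}) ->
  alternating B ->
  nondegenerate_form B ->
  s_good B Vg ->
  is_cochar Vg delta ->
  forall x : 'End(V), g2_bang B Vg delta x <-> s2_0 B Vg x.
Proof.
move=> _ alt nondeg [grad dims even_dim orth] dl x.
have deg : s_deg B Vg 2 x -> forall r v, v \in Vg r -> x v \in Vg (r + 2).
  by case=> _ xdeg r v rv; rewrite (subvP (xdeg r)) ?memv_img.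
split=> [[/(g_wt_s_deg _ _ _ grad dl) sx cent]|[sx iso]].
  split=> // n; have [spx _] := sx.
  have inj u : u \in Vg (- n%:Z) -> lfun_pow x n u = 0 -> u = 0.
    apply: (pow_inj_of_cent_ge0 alt nondeg grad orth spx (deg sx) cent) => en.
    by apply: even_dim; rewrite dvdzE abszN /= dvdn2.
  split.
    (* Surjectivity comes from injectivity and the equality of the dimensions of [V_n] and
       [V_{-n}]. *)
    apply/eqP; rewrite eqEdim; apply/andP; split.
      apply/subvP => _ /memv_imgP[u nu ->].
      by have := lfun_pow_mem (deg sx) n nu; congr (_ \in Vg _); lia.
    rewrite limg_dim_eq; first by have [-> _] := dims n%:Z isT.
    apply/eqP; rewrite -subv0; apply/subvP => u.
    by rewrite memv_cap memv_ker memv0 => /andP[nu /eqP/(inj u nu)->].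
  move=> u v nu nv e; apply/eqP; rewrite -subr_eq0; apply/eqP/inj.
    by rewrite rpredB.
  by rewrite linearB /= e subrr.
split; first exact/(g_wt_s_deg _ _ _ grad dl).
move=> g [Spg Adg]; split=> //; have [/eqP ker0 _] := Spg.
have [p [S [p_mem pE p_sum]]] := grading_projections grad.
have gx w : g (x w) = x (g w).
  have := congr1 (fun f : 'End(V) => f (g w)) Adg.
  by rewrite /Ad !comp_lfunE lker0_lfunK.
(* The reverse implication in [G_ge0] is the stability of [V_{>=a}] under the inverse, which
   commutes with [x] too. *)
have gVx w : (g^-1)%VF (x w) = x ((g^-1)%VF w).
  by rewrite -{1}[w](lker0_lfunVK ker0) -gx lker0_lfunK.
move=> a v; split; last exact: (commute_Vge p_mem pE p_sum (deg sx) iso gx).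
rewrite -{2}[v](lker0_lfunK ker0).
exact: (commute_Vge p_mem pE p_sum (deg sx) iso gVx).
Qed.
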